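(* (a) There exists an $\infty$-ample simplicial complex with a countable set of vertexes. (b) Any two $\infty$-ample simplicial complexes with countable sets of vertexes are isomorphic.
   Context: For $U\subseteq V(X)$, $X_U$ denotes the induced subcomplex on $U$; $\mathrm{Lk}_X(v)$ is the subcomplex of simplexes $\sigma$ with $v\notin\sigma$ and $\sigma\cup\{v\}\in X$. For an integer $r\ge1$, a nonempty simplicial complex $X$ is $r$-ample if for every finite $U\subseteq V(X)$ with $|U|\le r$ and every subcomplex $A\subseteq X_U$ (possibly empty) there exists $v\in V(X)\setminus U$ with $\mathrm{Lk}_X(v)\cap X_U=A$. $X$ is $\infty$-ample if it is $r$-ample for every $r\ge1$. *)

(* Defs.v *)
From mathcomp Require Import all_boot finmap.
From mathcomp Require Import boolp classical_sets functions cardinality.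

Set Implicit Arguments.
Unset Strict Implicit.
Unset Printing Implicit Defensive.

Local Open Scope classical_set_scope.

(* [T] is only an ambient type of labels: the vertex set of a complex is the
   subset [vertices X] of [T].  In this way subcomplexes, links and induced
   subcomplexes are again complexes over [T]; simplexes are nonempty, and the
   complex with no simplexes is allowed. *)
Record simplicial_complex (T : choiceType) := SimplicialComplex {
  simplexes : set {fset T};
  simplex_neq0 : forall s, simplexes s -> s != fset0;
  simplex_face : forall s t, simplexes s ->
    (t `<=` s)%fset -> t != fset0 -> simplexes t }.

Section Complexes.
Variable T : choiceType.
Implicit Types (X A : simplicial_complex T) (U s t : {fset T}) (v : T).

Definition vertices X : set T := [set v | simplexes X [fset v]%fset].

Definition subcomplex A X : Prop := simplexes A `<=` simplexes X.

Definition induced_simplexes X U : set {fset T} :=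
  [set s | simplexes X s /\ (s `<=` U)%fset].

Lemma induced_neq0 X U s : induced_simplexes X U s -> s != fset0.
Proof. by case=> /simplex_neq0. Qed.

Lemma induced_face X U s t : induced_simplexes X U s ->
  (t `<=` s)%fset -> t != fset0 -> induced_simplexes X U t.
Proof.
move=> [Xs sU] ts t0; split; first exact: simplex_face Xs ts t0.
exact: fsubset_trans ts sU.
Qed.

Definition induced X U : simplicial_complex T :=
  SimplicialComplex (@induced_neq0 X U) (@induced_face X U).

(* [s != fset0] is needed: otherwise the empty set would be a simplex of the
   link of every vertex. *)
Definition link_simplexes X v : set {fset T} :=
  [set s | [/\ s != fset0, v \notin s & simplexes X (v |` s)%fset]].

Lemma link_neq0 X v s : link_simplexes X v s -> s != fset0.
Proof. by case. Qed.

Lemma link_face X v s t : link_simplexes X v s ->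
  (t `<=` s)%fset -> t != fset0 -> link_simplexes X v t.
Proof.
move=> [_ vs Xvs] ts t0; split=> //.
  by apply: contra vs; exact: (fsubsetP ts).
apply: simplex_face Xvs (fsetUS _ ts) _.
by apply/fset0Pn; exists v; rewrite !inE eqxx.
Qed.

Definition link X v : simplicial_complex T :=
  SimplicialComplex (@link_neq0 X v) (@link_face X v).

Definition ample (r : nat) X : Prop :=
  vertices X !=set0 /\
  forall U, [set` U] `<=` vertices X -> #|` U| <= r ->
  forall A, subcomplex A (induced X U) ->
  exists v, [/\ vertices X v, v \notin U &
    simplexes (link X v) `&` simplexes (induced X U) = simplexes A].

Definition infty_ample X : Prop := forall r, 1 <= r -> ample r X.

End Complexes.

(* Only the restriction of [f] to [vertices X] matters; taking it total on [T]
   is harmless as soon as [Y] has a vertex. *)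
Definition isomorphic (T T' : choiceType)
    (X : simplicial_complex T) (Y : simplicial_complex T') : Prop :=
  exists f : T -> T', set_bij (vertices X) (vertices Y) f /\
    forall s : {fset T}, [set` s] `<=` vertices X ->
      (simplexes X s <-> simplexes Y [fset f x | x in s]%fset).

(* Main.v *)
Require Import Defs.
From mathcomp Require Import all_boot finmap.
From mathcomp Require Import boolp classical_sets functions cardinality.

(** Existence: let [F] enumerate the finite families of finite sets of naturals,
    each of them infinitely often, and let [s] be a simplex when every nonempty
    [t] contained in [s] and lying strictly below some [v] in [s] belongs to
    [F v].  A finite complex [A] on [U] is then the link, within [U], of any
    [v] above [U] with [F v = A].

    Uniqueness: back and forth.  A finite partial isomorphism [P] extends to a
    new vertex [x] by transporting the link of [x] along [P] and realizing it
    as a link on the other side, and a chain of such extensions exhausts both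
    vertex sets. *)

Set Implicit Arguments.
Unset Strict Implicit.
Unset Printing Implicit Defensive.

Local Open Scope classical_set_scope.
Local Open Scope fset_scope.

(** * The generic complex on the natural numbers *)

Section Existence.

(** The 2-adic valuation of [v] serves as the code, so that each family recurs at all odd multiples
    of a power of 2; a valuation that codes nothing yields the empty family. *)
Definition nth_family (v : nat) : {fset {fset nat}} :=
  odflt fset0 (choice.unpickle (logn 2 v)).

Lemma nth_family_unbounded (N : nat) (A : {fset {fset nat}}) :
  exists2 v, N < v & nth_family v = A.
Proof.
(* The odd factor keeps the valuation and pushes the product above [N]. *)
exists (2 ^ choice.pickle A * (2 * N).+1).
  by apply: leq_trans (leq_pmull _ _); rewrite ?expn_gt0// ltnS leq_pmull.
rewrite /nth_family lognM ?expn_gt0// pfactorK// logn_coprime ?addn0 ?choice.pickleK//.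
by rewrite coprime2n /= oddM.
Qed.

Definition generic_simplexes : set {fset nat} := [set s | s != fset0 /\
  forall v t, v \in s -> t `<=` s -> t != fset0 ->
    {in t, forall x, x < v} -> t \in nth_family v].

Lemma generic_neq0 s : generic_simplexes s -> s != fset0.
Proof. by case. Qed.

Lemma generic_face s t : generic_simplexes s -> t `<=` s -> t != fset0 ->
  generic_simplexes t.
Proof.
move=> [_ sF] ts t0; split=> // v u vt ut.
by apply: sF; [exact: (fsubsetP ts)|exact: fsubset_trans ts].
Qed.

Definition generic_complex : simplicial_complex nat :=
  SimplicialComplex generic_neq0 generic_face.

(** No nonempty subset of a singleton lies strictly below its element, so the condition is
    vacuous. *)
Lemma vertices_generic v : vertices generic_complex v.
Proof.
split=> [|w t]; first by apply/fset0Pn; exists v; rewrite inE.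
rewrite inE => /eqP-> tv /fset0Pn[x xt] /(_ x xt).
by have := fsubsetP tv x xt; rewrite inE => /eqP->; rewrite ltnn.
Qed.

(** A set strictly below some element of the enlarged set misses [v], its maximum, so only the
    conditions at [v] itself are new. *)
Lemma generic_fsetU1 (v : nat) (s : {fset nat}) :
  {in s, forall x, x < v} -> generic_simplexes s ->
  (forall t, t `<=` s -> t != fset0 -> t \in nth_family v) ->
  generic_simplexes (v |` s).
Proof.
move=> ltv [_ sF] vF; split.
  by apply/fset0Pn; exists v; rewrite !inE eqxx.
move=> w t wvs tvs t0 ltw.
have le_wv : w <= v.
  by move: wvs; rewrite !inE => /orP[/eqP->//|/ltv/ltnW].
have ts : t `<=` s.
  apply/fsubsetP => x xt; have := fsubsetP tvs x xt.
  rewrite !inE => /orP[/eqP xv|//].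
  by have := ltw x xt; rewrite xv ltnNge le_wv.
move: wvs; rewrite !inE => /orP[/eqP->|ws]; first exact: vF.
exact: sF.
Qed.

Lemma generic_infty_ample : infty_ample generic_complex.
Proof.
move=> r _; split; first by exists 0; exact: vertices_generic.
move=> U _ _ A AU.
(* All simplexes of [A] lie in the finite powerset of [U], so [A] is a finite family. *)
pose FA := [fset s in fpowerset U | `[< simplexes A s >]].
have FAP s : reflect (simplexes A s) (s \in FA).
  apply: (iffP idP); rewrite !inE /=; first by case/andP=> _ /asboolP.
  by move=> As; rewrite fpowersetE (AU _ As).2; apply/asboolP.
have [v ltv vFA] := nth_family_unbounded (\max_(x <- U) x) FA.
have Uv : {in U, forall x, x < v}.
  by move=> x xU; apply: leq_ltn_trans ltv; apply: leq_bigmax_seq.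
have vU : v \notin U by apply/negP => /Uv; rewrite ltnn.
exists v; split=> //; first exact: vertices_generic.
apply/seteqP; split=> s /=.
  (* The defining condition of the simplex made of [v] and [s], taken at [v] and at [s] itself, puts
     [s] in [FA]. *)
  move=> [[s0 vs Xvs] [_ sU]]; case: Xvs => _ /(_ v s).
  rewrite vFA => sF; apply/FAP; apply: sF => //.
  - by rewrite !inE eqxx.
  - exact: fsubsetUr.
  - by move=> x xs; apply/Uv/(fsubsetP sU).
move=> As; have [Xs sU] := AU _ As; split=> //; split.
- exact: simplex_neq0 As.
- by apply: contra vU; exact: (fsubsetP sU).
- apply: generic_fsetU1 => // [x xs|t ts t0].
    by apply/Uv/(fsubsetP sU).
  by rewrite vFA; apply/FAP; exact: simplex_face As ts t0.
Qed.

End Existence.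

(** * Realizing links; finite partial isomorphisms and their inverses *)

Lemma infty_ample_link (T : choiceType) (X A : simplicial_complex T)
    (U : {fset T}) :
  infty_ample X -> ([set` U] `<=` vertices X)%classic ->
  subcomplex A (induced X U) ->
  exists v, [/\ vertices X v, v \notin U &
    (simplexes (link X v) `&` simplexes (induced X U) = simplexes A)%classic].
Proof.
move=> ampX UX AU.
(* The successor secures [1 <= r] even when [U] is empty. *)
by have [_ /(_ U UX (leqnSn _) A AU)] := ampX #|` U|.+1 isT.
Qed.

(* A finite partial isomorphism is encoded by its graph. *)
Definition partial_iso (T T' : choiceType)
    (X : simplicial_complex T) (Y : simplicial_complex T')
    (P : {fset T * T'}) : Prop :=
  [/\ forall p, p \in P -> vertices X p.1 /\ vertices Y p.2,
      {in P &, forall p q, p.1 = q.1 <-> p.2 = q.2} &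
      forall Q : {fset T * T'}, Q `<=` P ->
        (simplexes X [fset p.1 | p in Q] <-> simplexes Y [fset p.2 | p in Q])].

Definition swap_graph (T T' : choiceType) (P : {fset T * T'}) : {fset T' * T} :=
  [fset (p.2, p.1) | p in P].

Section SwapGraph.
Variables T T' : choiceType.
Implicit Type P : {fset T * T'}.

Lemma in_swap_graph P x y : ((y, x) \in swap_graph P) = ((x, y) \in P).
Proof.
apply/imfsetP/idP => [[[x' y'] /= xyP [-> ->]]//|xyP].
by exists (x, y).
Qed.

Lemma swap_graph_fst P : [fset p.1 | p in swap_graph P] = [fset p.2 | p in P].
Proof.
apply/fsetP => y; apply/imfsetP/imfsetP => /= -[[a b] /= abP ->].
  by exists (b, a) => //; rewrite -in_swap_graph.
by exists (b, a) => //; rewrite in_swap_graph.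
Qed.

Lemma swap_graph_snd P : [fset p.2 | p in swap_graph P] = [fset p.1 | p in P].
Proof.
apply/fsetP => y; apply/imfsetP/imfsetP => /= -[[a b] /= abP ->].
  by exists (b, a) => //; rewrite -in_swap_graph.
by exists (b, a) => //; rewrite in_swap_graph.
Qed.

End SwapGraph.

Lemma swap_graphK (T T' : choiceType) :
  cancel (@swap_graph T T') (@swap_graph T' T).
Proof. by move=> P; apply/fsetP => -[x y]; rewrite !in_swap_graph. Qed.

Lemma swap_graphS (T T' : choiceType) (P Q : {fset T * T'}) :
  P `<=` Q -> swap_graph P `<=` swap_graph Q.
Proof.
move=> /fsubsetP PQ; apply/fsubsetP => -[y x]; rewrite !in_swap_graph.
exact: PQ.
Qed.

(** The definition is symmetric in the two sides; this reduces the back step to the forth step. *)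
Lemma partial_iso_swap (T T' : choiceType) (X : simplicial_complex T)
    (Y : simplicial_complex T') (P : {fset T * T'}) :
  partial_iso X Y P -> partial_iso Y X (swap_graph P).
Proof.
move=> [PXY Pinj Piso]; split=> [[y x]|[y x] [y' x']|Q QP].
- by rewrite in_swap_graph => /PXY[].
- rewrite !in_swap_graph => xyP xyP'.
  by have /= := Pinj _ _ xyP xyP'; apply: iff_sym.
- have /Piso : swap_graph Q `<=` P by rewrite -(swap_graphK P) swap_graphS.
  by rewrite swap_graph_fst swap_graph_snd; apply: iff_sym.
Qed.

(** * One-vertex extension by transport of a link *)

Section Extension.
Variables (T T' : choiceType).
Variables (X : simplicial_complex T) (Y : simplicial_complex T').
Implicit Types P Q : {fset T * T'}.

Lemma partial_iso0 : partial_iso X Y fset0.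
Proof.
split=> // Q; rewrite fsubset0 => /eqP->; rewrite !imfset0.
by split=> /simplex_neq0; rewrite eqxx.
Qed.

Section TransportedLink.
Variables (P : {fset T * T'}) (x : T).

(** For [x] outside the domain of [P], this is the link of [x] within that domain, carried to the
    other side. Subgraphs [Q] stand for faces, so that [P] never has to be applied as a function. *)
Definition tlink_simplexes : set {fset T'} := [set s | exists Q,
  [/\ Q `<=` P, Q != fset0, s = [fset p.2 | p in Q] &
      simplexes X (x |` [fset p.1 | p in Q])]].

Lemma tlink_neq0 s : tlink_simplexes s -> s != fset0.
Proof.
move=> [Q [_ /fset0Pn[p pQ] -> _]]; apply/fset0Pn; exists p.2.
exact: in_imfset.
Qed.

Lemma tlink_face s t : tlink_simplexes s -> t `<=` s -> t != fset0 ->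
  tlink_simplexes t.
Proof.
move=> [Q [QP _ -> XQ]] /fsubsetP tQ t0.
pose Q' := [fset p in Q | p.2 \in t].
have Q'Q : Q' `<=` Q by apply/fsubsetP => p; rewrite !inE => /andP[].
have tQ' : t = [fset p.2 | p in Q'].
  apply/fsetP => y; apply/idP/imfsetP => [yt|[p /= + ->]].
    have /imfsetP[p /= pQ yp] := tQ _ yt.
    by exists p => //; rewrite !inE /= pQ -yp.
  by rewrite !inE => /andP[].
exists Q'; split=> //; first exact: fsubset_trans QP.
  by apply: contra_neq t0; rewrite tQ' => ->; rewrite imfset0.
apply: simplex_face XQ _ _.
  apply: fsetUS; apply/fsubsetP => _ /imfsetP[p /= pQ' ->].
  by apply: in_imfset; exact: (fsubsetP Q'Q).
by apply/fset0Pn; exists x; rewrite !inE eqxx.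
Qed.

Definition tlink : simplicial_complex T' :=
  SimplicialComplex tlink_neq0 tlink_face.

Hypothesis Piso : partial_iso X Y P.

(** Dropping [x] leaves a simplex in the domain of [P], which [P] carries to a simplex of [Y]. *)
Lemma tlink_subcomplex : subcomplex tlink (induced Y [fset p.2 | p in P]).
Proof.
have [_ _ PXY] := Piso.
move=> _ [Q [QP /fset0Pn[p pQ] -> XQ]]; split.
  apply/(PXY Q QP); apply: simplex_face XQ (fsubsetUr _ _) _.
  by apply/fset0Pn; exists p.1; exact: in_imfset.
apply/fsubsetP => _ /imfsetP[q /= qQ ->].
by apply: in_imfset; exact: (fsubsetP QP).
Qed.

(** As [P] is injective, a subgraph is recovered from its second projection, so the witness hidden
    in the left side must be [Q]. *)
Lemma tlinkE Q : Q `<=` P -> Q != fset0 ->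
  simplexes tlink [fset p.2 | p in Q] <->
  simplexes X (x |` [fset p.1 | p in Q]).
Proof.
move=> QP Q0; split=> [[Q' [Q'P _ QQ' XQ']]|XQ]; last by exists Q.
suff -> : Q = Q' by [].
have [_ Pinj _] := Piso.
have sub (A B : {fset T * T'}) : A `<=` P -> B `<=` P ->
    [fset p.2 | p in A] = [fset p.2 | p in B] -> A `<=` B.
  move=> /fsubsetP AP /fsubsetP BP AB; apply/fsubsetP => p pA.
  have : p.2 \in [fset p.2 | p in B] by rewrite -AB in_imfset.
  move=> /imfsetP[q /= qB pq2].
  have pq1 := (Pinj p q (AP _ pA) (BP _ qB)).2 pq2.
  by rewrite [p]surjective_pairing pq1 pq2 -surjective_pairing.
by apply/eqP; rewrite eqEfsubset; apply/andP; split; apply: sub.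
Qed.

End TransportedLink.

Lemma partial_iso_extend P x : infty_ample Y -> partial_iso X Y P ->
  vertices X x -> exists P', [/\ partial_iso X Y P', P `<=` P' &
    exists y, (x, y) \in P'].
Proof.
move=> ampY Piso Xx; have [PV Pinj PXY] := Piso.
have [/imfsetP[[x' y] /= xyP xE]|xP] := boolP (x \in [fset p.1 | p in P]).
  by exists P; split=> //; exists y; rewrite xE.
have UY : ([set` [fset p.2 | p in P]] `<=` vertices Y)%classic.
  by move=> _ /imfsetP[p /= pP ->]; exact: (PV p pP).2.
(* The partner [y] has the transported link as its link within the range of [P]. *)
have [y [Yy yP lk]] := infty_ample_link ampY UY (tlink_subcomplex Piso (x := x)).
have nx p : p \in P -> p.1 <> x.
  by move=> pP px; move: xP; rewrite -px in_imfset.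
have ny p : p \in P -> p.2 <> y.
  by move=> pP py; move: yP; rewrite -py in_imfset.
exists ((x, y) |` P); split; last by exists y; rewrite !inE eqxx.
- split.
  + by move=> p; rewrite !inE => /orP[/eqP->//|/PV].
  + move=> p q; rewrite !inE => /orP[/eqP->|pP] /orP[/eqP->|qP] //=.
    * by split=> /esym; [move/(nx _ qP)|move/(ny _ qP)].
    * by split=> [/(nx _ pP)|/(ny _ pP)].
    * exact: Pinj.
  + move=> Q QP.
    (* Only subgraphs through [(x, y)] are new; [R] below is the rest of such a subgraph. *)
    have Q1P : Q `\ (x, y) `<=` P by rewrite fsubDset.
    have [xyQ|xyQ] := boolP ((x, y) \in Q); last first.
      by apply: PXY; rewrite -(mem_fsetD1 xyQ).
    rewrite -(fsetD1K xyQ); move: (Q `\ (x, y)) Q1P => R RP {Q QP xyQ}.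
    rewrite !imfsetU1 /=.
    (* For empty [R] the two sides say that [x] and [y] are vertices. *)
    have [->|R0] := eqVneq R fset0.
      by rewrite !imfset0 !fsetU0.
    apply: iff_trans (iff_sym (tlinkE x Piso RP R0)) _.
    have RU : [fset p.2 | p in R] `<=` [fset p.2 | p in P].
      apply/fsubsetP => _ /imfsetP[p /= pR ->].
      by apply: in_imfset; exact: (fsubsetP RP).
    have R20 : [fset p.2 | p in R] != fset0.
      have /fset0Pn[p pR] := R0.
      by apply/fset0Pn; exists p.2; exact: in_imfset.
    rewrite -lk; split=> [[[]]//|YR]; split; split=> //.
      by apply: contra yP; exact: (fsubsetP RU).
    exact: simplex_face YR (fsubsetUr _ _) R20.
- exact: fsubsetUr.
Qed.

End Extension.

(** * The back-and-forth construction *)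

(** Each numbering, being injective, gives the number [n] to at most one vertex, so one forth step
    and one back step suffice at stage [n]. *)
Lemma partial_iso_extend_both (T T' : choiceType) (X : simplicial_complex T)
    (Y : simplicial_complex T') (P : {fset T * T'})
    (g : T -> nat) (g' : T' -> nat) (n : nat) :
  infty_ample X -> infty_ample Y ->
  {in vertices X &, injective g} -> {in vertices Y &, injective g'} ->
  partial_iso X Y P -> exists P', [/\ partial_iso X Y P', P `<=` P',
    forall x, vertices X x -> g x = n -> exists y, (x, y) \in P' &
    forall y, vertices Y y -> g' y = n -> exists x, (x, y) \in P'].
Proof.
move=> ampX ampY ginj g'inj Piso.
have [P1 [P1iso PP1 P1x]] : exists P1, [/\ partial_iso X Y P1, P `<=` P1 &
    forall x, vertices X x -> g x = n -> exists y, (x, y) \in P1].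
  have [[x [Xx gx]]|nox] := pselect (exists x, vertices X x /\ g x = n).
    have [P1 [P1iso PP1 P1x]] := partial_iso_extend ampY Piso Xx.
    exists P1; split=> // x' Xx' gx'.
    by rewrite (ginj x' x) ?inE ?gx.
  by exists P; split=> // x Xx gx; case: nox; exists x.
have [[y [Yy gy]]|noy] := pselect (exists y, vertices Y y /\ g' y = n).
  have [P2 [P2iso P1P2 [x yxP2]]] :=
    partial_iso_extend ampX (partial_iso_swap P1iso) Yy.
  have P1P2' : P1 `<=` swap_graph P2 by rewrite -(swap_graphK P1) swap_graphS.
  exists (swap_graph P2); split=> [||x' Xx' /(P1x _ Xx')[y' xyP1]|y' Yy' gy'].
  - exact: partial_iso_swap.
  - exact: fsubset_trans P1P2'.
  - by exists y'; exact: (fsubsetP P1P2').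
  - by exists x; rewrite in_swap_graph (g'inj y' y) ?inE ?gy.
by exists P1; split=> // y Yy gy; case: noy; exists y.
Qed.

Lemma infty_ample_isomorphic (T T' : choiceType)
    (X : simplicial_complex T) (Y : simplicial_complex T') :
  countable (vertices X) -> infty_ample X ->
  countable (vertices Y) -> infty_ample Y -> isomorphic X Y.
Proof.
move=> /countable_injP[g ginj] ampX /countable_injP[g' g'inj] ampY.
(* The implication under the existential lets choice produce a total [ext], unconstrained off
   partial isomorphisms. *)
have /choice[ext extP] (nP : nat * {fset T * T'}) : exists P',
    partial_iso X Y nP.2 -> [/\ partial_iso X Y P', nP.2 `<=` P',
    forall x, vertices X x -> g x = nP.1 -> exists y, (x, y) \in P' &
    forall y, vertices Y y -> g' y = nP.1 -> exists x, (x, y) \in P'].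
  have [Piso|] := pselect (partial_iso X Y nP.2); last by exists fset0.
  have [P' ?] := partial_iso_extend_both nP.1 ampX ampY ginj g'inj Piso.
  by exists P'.
pose P := fix P n := if n is m.+1 then ext (m, P m) else fset0.
have Piso n : partial_iso X Y (P n).
  by elim: n => [|n /(extP (n, P n))[]//]; exact: partial_iso0.
have Pstep n := extP (n, P n) (Piso n).
have Pmono m n : m <= n -> P m `<=` P n.
  elim: n => [|n IHn]; first by rewrite leqn0 => /eqP->.
  rewrite leq_eqVlt => /orP[/eqP->//|/IHn/fsubset_trans]; apply.
  by have [] := Pstep n.
(* Any two pairs of the chain lie in a common stage, so its union is the graph of an injective
   function. *)
have Pmax m n p q : p \in P m -> q \in P n -> p.1 = q.1 <-> p.2 = q.2.
  move=> pP qP; have [_ + _] := Piso (maxn m n); apply.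
    exact: (fsubsetP (Pmono _ _ (leq_maxl m n))).
  exact: (fsubsetP (Pmono _ _ (leq_maxr m n))).
(* Some point of [T'] is needed to make [f] total on [T]. *)
have [[y0 _] _] := ampY 1 isT.
have /choice[f fP] (x : T) : exists y, vertices X x -> (x, y) \in P (g x).+1.
  have [Xx|] := pselect (vertices X x); last by exists y0.
  have [_ _ /(_ x Xx erefl)[y xyP] _] := Pstep (g x).
  by exists y.
exists f; split; first split.
- move=> x Xx; have [PV _ _] := Piso (g x).+1.
  exact: (PV _ (fP x Xx)).2.
- move=> x x' /set_mem Xx /set_mem Xx'.
  exact: (Pmax _ _ _ _ (fP x Xx) (fP x' Xx')).2.
(* The back steps pair [y] with some [x], and [Pmax] then forces [f x = y]. *)
- move=> y Yy; have [_ _ _ /(_ y Yy erefl)[x xyP]] := Pstep (g' y).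
  have [PV _ _] := Piso (g' y).+1.
  have Xx : vertices X x := (PV _ xyP).1.
  exists x => //.
  exact: (Pmax _ (g' y).+1 (x, f x) (x, y) (fP x Xx) xyP).1 erefl.
move=> s sX.
(* By stage [N] every vertex of [s] is paired with its image, so the graph of [f] on [s] is a
   subgraph of [P N]. *)
pose N := \max_(x <- s) (g x).+1.
have [_ _ /(_ [fset (x, f x) | x in s])] := Piso N.
have -> : [fset p.1 | p in [fset (x, f x) | x in s]] = s.
  by rewrite -imfset_comp /= imfset_id.
have -> : [fset p.2 | p in [fset (x, f x) | x in s]] = [fset f x | x in s].
  by rewrite -imfset_comp.
apply; apply/fsubsetP => _ /imfsetP[x /= xs ->].
apply: (fsubsetP (Pmono _ _ _) _ (fP x (sX x xs))).
exact: (leq_bigmax_seq (F := fun x => (g x).+1)).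
Qed.

Theorem theorem9p1 :
  (exists (T : choiceType) (X : simplicial_complex T),
     countable (vertices X) /\ infty_ample X) /\
  (forall (T T' : choiceType)
     (X : simplicial_complex T) (Y : simplicial_complex T'),
     countable (vertices X) -> infty_ample X ->
     countable (vertices Y) -> infty_ample Y ->
     isomorphic X Y).
Proof.
split; last exact: infty_ample_isomorphic.
exists nat, generic_complex; split; last exact: generic_infty_ample.
exact: countableP.
Qed.
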